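(* Let $R$ be a ring. (a) Every almost projective $R$-module $M_0$ can be represented as $M/L$, where $M$ is a Tate $R$-module and $L\subset M$ is a bounded open submodule. (b) If $M_0$ is 2-almost projective, then in such a representation $L$ is a lattice.
   Context: An $R$-module is almost projective if it is a direct summand of a module of the form $P\oplus F$ with $P$ projective and $F$ finitely generated; it is 2-almost projective if it is a direct summand of $P\oplus F$ with $P$ projective and $F$ of finite presentation. A Tate $R$-module is a topological direct summand of $P\oplus Q^*$ with $P$ a discrete projective left $R$-module, $Q$ a discrete projective right $R$-module and $Q^*=\operatorname{Hom}_R(Q,R)$ with topology of pointwise convergence. A lattice in a Tate module $M$ is an open submodule $L$ such that $L/U$ is finitely generated for every open submodule $U\subset L$; a subset of $M$ is bounded if it is contained in some lattice. *)

(* Defs.v *)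
(* R : pzRingType (possibly noncommutative, unital; the zero
   ring is allowed). Left R-modules are lmodType R; right R-modules are
   left modules over the converse ring R^c. *)
From HB Require Import structures.
From mathcomp Require Import all_boot all_order all_algebra.
Set Implicit Arguments. Unset Strict Implicit. Unset Printing Implicit Defensive.
Import GRing.Theory.
Local Open Scope ring_scope.

Section Defs.
Variable R : pzRingType.

Definition lin (U V : lmodType R) (f : U -> V) : Prop :=
  forall (a : R) (x y : U), f (a *: x + y) = a *: f x + f y.

Definition submod (M : lmodType R) (S : M -> Prop) : Prop :=
  S 0 /\ forall (a : R) (x y : M), S x -> S y -> S (a *: x + y).

Definition projective (P : lmodType R) : Prop :=
  forall (A B : lmodType R) (g : A -> B) (f : P -> B),
    lin g -> (forall b, exists a, g a = b) -> lin f ->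
    exists h : P -> A, lin h /\ forall x, g (h x) = f x.

Definition fin_gen (F : lmodType R) : Prop :=
  exists (n : nat) (s : 'I_n -> F),
    forall x : F, exists c : 'I_n -> R, x = \sum_(i < n) c i *: s i.

Definition fin_pres (F : lmodType R) : Prop :=
  exists (n : nat) (s : 'I_n -> F),
    (forall x : F, exists c : 'I_n -> R, x = \sum_(i < n) c i *: s i) /\
    exists (m : nat) (rel : 'I_m -> 'I_n -> R),
      (forall j, \sum_(i < n) rel j i *: s i = 0) /\
      (forall c : 'I_n -> R, \sum_(i < n) c i *: s i = 0 ->
         exists d : 'I_m -> R, forall i, c i = \sum_(j < m) d j * rel j i).

Definition dsummand (M N : lmodType R) : Prop :=
  exists (i : M -> N) (p : N -> M), lin i /\ lin p /\ forall x, p (i x) = x.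

Definition almost_projective (M0 : lmodType R) : Prop :=
  exists (P F : lmodType R), projective P /\ fin_gen F /\ dsummand M0 (P * F)%type.

Definition two_almost_projective (M0 : lmodType R) : Prop :=
  exists (P F : lmodType R), projective P /\ fin_pres F /\ dsummand M0 (P * F)%type.
End Defs.

(* Right R-modules are left R^c-modules; for Q : lmodType R^c, the
   R^c-scaling a *: q is the right action q.a.  Q^* = Hom_R(Q,R) is the set of
   f : Q -> R with f (q.a + q') = f q * a + f q'. *)
Definition rlin (R : pzRingType) (Q : lmodType R^c) (f : Q -> R) : Prop :=
  forall (a : R) (q q' : Q), f ((a : R^c) *: q + q') = f q * a + f q'.

(* Open sets of P (+) Q^*, elements written as pairs (x, f) with f in Q^*:
   P carries the discrete topology, Q^* the topology of pointwise convergence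
   (R discrete), and P (+) Q^* the product topology.  U is open iff for each
   (x,f) in U there is a finite list qs of elements of Q such that every
   (x,g) with g in Q^* agreeing with f on qs lies in U. *)
Definition PQ_open (R : pzRingType) (P : lmodType R) (Q : lmodType R^c)
    (U : P -> (Q -> R) -> Prop) : Prop :=
  (forall x f, U x f -> rlin f) /\
  forall x f, U x f -> exists qs : seq Q,
    forall g, rlin g -> (forall q, q \in qs -> g q = f q) -> U x g.

(* A Tate module: a left R-module M with topology (given by its family of
   open sets T) which is a topological direct summand of P (+) Q^*, i.e.
   there are continuous R-linear maps i : M -> P (+) Q^* and
   p : P (+) Q^* -> M with p o i = id.  i = (i1, i2). *)
Definition tate (R : pzRingType) (M : lmodType R) (T : (M -> Prop) -> Prop) : Prop :=
  exists (P : lmodType R) (Q : lmodType R^c),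
    projective P /\ projective Q /\
    exists (i1 : M -> P) (i2 : M -> Q -> R) (p : P -> (Q -> R) -> M),
      lin i1 /\
      (forall m, rlin (i2 m)) /\
      (forall (a : R) (m m' : M) (q : Q), i2 (a *: m + m') q = a * i2 m q + i2 m' q) /\
      (forall (a : R) (x x' : P) (f f' : Q -> R), rlin f -> rlin f' ->
         p (a *: x + x') (fun q => a * f q + f' q) = a *: p x f + p x' f') /\
      (forall m, p (i1 m) (i2 m) = m) /\
      (forall U, PQ_open U -> T (fun m => U (i1 m) (i2 m))) /\
      (forall V, T V -> PQ_open (fun x f => rlin f /\ V (p x f))).

Definition open_submod (R : pzRingType) (M : lmodType R) (T : (M -> Prop) -> Prop)
    (L : M -> Prop) : Prop := submod L /\ T L.

Definition lattice (R : pzRingType) (M : lmodType R) (T : (M -> Prop) -> Prop)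
    (L : M -> Prop) : Prop :=
  open_submod T L /\
  forall U : M -> Prop, open_submod T U -> (forall x, U x -> L x) ->
    exists (n : nat) (s : 'I_n -> M), (forall i, L (s i)) /\
      forall x, L x -> exists c : 'I_n -> R, U (x - \sum_(i < n) c i *: s i).

Definition bounded (R : pzRingType) (M : lmodType R) (T : (M -> Prop) -> Prop)
    (S : M -> Prop) : Prop :=
  exists L, lattice T L /\ forall x, S x -> L x.

Definition quot_rep (R : pzRingType) (M M0 : lmodType R) (L : M -> Prop)
    (pi : M -> M0) : Prop :=
  lin pi /\ (forall y, exists x, pi x = y) /\ (forall x, pi x = 0 <-> L x).

(* Main.v *)
(** Write [N0 = P (+) F] and let [rho : P (+) R^n -> N0] be a presentation.

    (a) An idempotent [e] of [N0] with image [M0] lifts to an endomorphism [p] of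
    [G = P (+) R^n], idempotent modulo the kernel of [rho].  After replacing [p] by
    [3 p^2 - 2 p^3] the error factors as [p - p^2 = b a] through [V = R^n].  Then
    the error can be pushed into a new summand: [e] lifts to an endomorphism of
    [G (+) V (+) V] whose error again factors through [V] and vanishes after
    projection to [G].  Iterating and passing to the limit gives a continuous
    idempotent of [G (+) prod_k (V (+) V)] lifting [e]; its image is the Tate
    module [M], and [L] is the kernel of [M -> M0].

    (b) Lift the projection [P (+) F -> M0] to [sig : P (+) R^n -> M], and the map
    [M -> M0 -> P (+) F], which has open kernel, to [lam : M -> P (+) R^n] with
    open kernel.  Then [1 - sig lam] maps [M] into [L], so for a lattice
    [Lam] containing [L] one has [L = (1 - sig lam) Lam + sig K] with [K] the
    finitely generated module of relations of [F]. *)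
Require Import Defs.
From HB Require Import structures.
From mathcomp Require Import all_boot all_order all_algebra.
From mathcomp Require Import boolp functions.
Set Implicit Arguments. Unset Strict Implicit. Unset Printing Implicit Defensive.
Import GRing.Theory.
Local Open Scope ring_scope.

(* Expressions decided by the reflexive tactic [abel], which proves identities
   valid in all abelian groups. *)
Inductive zexpr : Type :=
  | ZVar of nat | ZZero | ZAdd of zexpr & zexpr | ZOpp of zexpr
  | ZMuln of zexpr & nat.

Fixpoint zeval (V : zmodType) (env : seq V) (e : zexpr) : V :=
  match e with
  | ZVar i => env`_i
  | ZZero => 0
  | ZAdd e1 e2 => zeval env e1 + zeval env e2
  | ZOpp e1 => - zeval env e1
  | ZMuln e1 n => zeval env e1 *+ n
  end.

Fixpoint zcoef (e : zexpr) (i : nat) : int :=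
  match e with
  | ZVar j => (j == i)%:Z
  | ZZero => 0
  | ZAdd e1 e2 => zcoef e1 i + zcoef e2 i
  | ZOpp e1 => - zcoef e1 i
  | ZMuln e1 n => zcoef e1 i *+ n
  end.

Lemma zevalE (V : zmodType) (env : seq V) (e : zexpr) :
  zeval env e = \sum_(i < size env) env`_i *~ zcoef e i.
Proof.
elim: e => [j||e1 IH1 e2 IH2|e1 IH1|e1 IH1 n] /=.
- have [ltj|lej] := ltnP j (size env).
    rewrite (bigD1 (Ordinal ltj)) //= eqxx mulr1z big1 ?addr0 // => i /negP nij.
    by case: eqP => // eij; case: nij; apply/eqP/val_inj.
  rewrite nth_default // big1 // => i _.
  by case: eqP => // eij; have := ltn_ord i; rewrite -eij ltnNge lej.
- by rewrite big1.
- by rewrite IH1 IH2 -big_split; apply: eq_bigr => i _; rewrite mulrzDr.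
- by rewrite IH1 -sumrN; apply: eq_bigr => i _; rewrite mulrNz.
- by rewrite IH1 -sumrMnl; apply: eq_bigr => i _; rewrite -[zcoef _ _ *+ n]mulr_natr natz mulrzA.
Qed.

(** The integer coefficients compute even when the atoms are opaque, so the hypothesis reduces to
    [isT]. *)
Lemma zeval_eq (V : zmodType) (env : seq V) (e1 e2 : zexpr) :
  all (fun i => zcoef e1 i == zcoef e2 i) (iota 0 (size env)) ->
  zeval env e1 = zeval env e2.
Proof.
move=> /allP eqc; rewrite !zevalE; apply: eq_bigr => i _.
by rewrite (eqP (eqc _ _)) // mem_iota /=.
Qed.

Ltac zatom_index a l :=
  lazymatch l with
  | ?b :: ?l' =>
      match constr:(Set) with
      | _ => let _ := match constr:(Set) with _ => constr_eq_strict a b end in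
             constr:(0%N)
      | _ => let n := zatom_index a l' in constr:(S n)
      end
  | _ => fail
  end.

Ltac zatoms_add a l :=
  match constr:(Set) with
  | _ => let n := zatom_index a l in l
  | _ => constr:(a :: l)
  end.

Ltac zatoms t l :=
  lazymatch t with
  | @GRing.zero _ => l
  | @GRing.add _ ?x ?y => let l1 := zatoms x l in zatoms y l1
  | @GRing.opp _ ?x => zatoms x l
  | @GRing.natmul _ ?x ?n => zatoms x l
  | ?x => zatoms_add x l
  end.

Ltac zreify t l :=
  lazymatch t with
  | @GRing.zero _ => constr:(ZZero)
  | @GRing.add _ ?x ?y =>
      let e1 := zreify x l in let e2 := zreify y l in constr:(ZAdd e1 e2)
  | @GRing.opp _ ?x => let e := zreify x l in constr:(ZOpp e)
  | @GRing.natmul _ ?x ?n => let e := zreify x l in constr:(ZMuln e n)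
  | ?x => let n := zatom_index x l in constr:(ZVar n)
  end.

Ltac abel :=
  lazymatch goal with
  | |- @eq ?T ?x ?y =>
      let l0 := zatoms x (@nil T) in
      let l := zatoms y l0 in
      let e1 := zreify x l in
      let e2 := zreify y l in
      exact: (@zeval_eq _ l e1 e2 isT)
  end.

(** * Linear maps and sums of projective modules *)

Section Linear.
Variable R : pzRingType.
Implicit Types A B C : lmodType R.

Section Maps.
Variables (A B : lmodType R) (f : A -> B).
Hypothesis linf : lin f.

Lemma linD x y : f (x + y) = f x + f y.
Proof. by rewrite -[x]scale1r linf !scale1r. Qed.

Lemma lin0 : f 0 = 0.
Proof. by apply: (addrI (f 0)); rewrite -linD !addr0. Qed.

Lemma linZ a x : f (a *: x) = a *: f x.
Proof. by rewrite -[a *: x]addr0 linf lin0 addr0. Qed.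

Lemma linN x : f (- x) = - f x.
Proof. by rewrite -scaleN1r linZ scaleN1r. Qed.

Lemma linB x y : f (x - y) = f x - f y.
Proof. by rewrite linD linN. Qed.

Lemma linMn x n : f (x *+ n) = f x *+ n.
Proof. by elim: n => [|n IH]; rewrite ?mulr0n ?lin0 // !mulrS linD IH. Qed.

Lemma lin_sum (I : Type) (r : seq I) (F : I -> A) :
  f (\sum_(i <- r) F i) = \sum_(i <- r) f (F i).
Proof. by elim/big_rec2: _ => [|i y1 y2 _ <-]; rewrite ?lin0 ?linD. Qed.

End Maps.

Lemma lin_comp A B C (g : B -> C) (f : A -> B) :
  lin g -> lin f -> lin (fun x => g (f x)).
Proof. by move=> ling linf a x y; rewrite linf ling. Qed.

Lemma projective_pair A B :
  projective A -> projective B -> projective (A * B)%type.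
Proof.
move=> projA projB C D g f ling surjg linf.
have linl : lin (fun x : A => (x, 0) : (A * B)%type).
  by move=> a x y; congr (_, _); rewrite /= scaler0 addr0.
have linr : lin (fun x : B => (0, x) : (A * B)%type).
  by move=> a x y; congr (_, _); rewrite /= scaler0 addr0.
have [hl [linhl hlE]] := projA _ _ _ _ ling surjg (lin_comp linf linl).
have [hr [linhr hrE]] := projB _ _ _ _ ling surjg (lin_comp linf linr).
exists (fun x => hl x.1 + hr x.2); split.
  by move=> a [x1 x2] [y1 y2] /=; rewrite linhl linhr scalerDr; abel.
case=> x y; rewrite linD // hlE hrE -linD //; congr (f (_, _)) => /=.
  by rewrite addr0.
by rewrite add0r.
Qed.

End Linear.

(** * Free modules on a set *)

Section FreeModule.
Variables (R : pzRingType) (I : choiceType).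

Definition finsupp : {pred I -> R^o} :=
  [pred f | `[< exists s : seq I, forall i, i \notin s -> f i = 0 >]].

Lemma finsuppP (f : I -> R^o) :
  reflect (exists s : seq I, forall i, i \notin s -> f i = 0) (f \in finsupp).
Proof. exact: asboolP. Qed.

Fact finsupp_submod_closed : submod_closed finsupp.
Proof.
split=> [|a f g /finsuppP[s fs] /finsuppP[t gt]]; apply/finsuppP.
  by exists [::].
exists (s ++ t) => i; rewrite mem_cat negb_or => /andP[nis nit].
by rewrite !fctE fs // gt // scaler0 addr0.
Qed.
HB.instance Definition _ :=
  GRing.isSubmodClosed.Build R (I -> R^o) finsupp finsupp_submod_closed.

Record freemod := FreeMod { free_val : I -> R^o; _ : free_val \in finsupp }.
HB.instance Definition _ := [isSub for free_val].
HB.instance Definition _ := [Choice of freemod by <:].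
HB.instance Definition _ := [SubChoice_isSubLmodule of freemod by <:].

End FreeModule.

(** Both sums have the same nonzero terms up to permutation. This frees [free_ext] from the support
    list picked by choice. *)
Lemma big_uniq_support (I : eqType) (V : nmodType) (s t : seq I) (F : I -> V) :
  uniq s -> uniq t -> (forall i, i \notin s -> F i = 0) ->
  (forall i, i \notin t -> F i = 0) ->
  \sum_(i <- s) F i = \sum_(i <- t) F i.
Proof.
move=> us ut Fs Ft; pose P i := F i != 0.
have F0 i : ~~ P i -> F i = 0 by move/negPn/eqP.
rewrite -[LHS](big_rmcond P) // -[RHS](big_rmcond P) //.
rewrite -[LHS]big_filter -[RHS]big_filter.
apply/perm_big/uniq_perm; rewrite ?filter_uniq // => i.
rewrite !mem_filter /P; case: eqP => //= Fi.
have -> : i \in s by apply: contra_notT Fi => /Fs.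
by have -> : i \in t by apply: contra_notT Fi => /Ft.
Qed.

Section FreeModuleTheory.
Variables (R : pzRingType) (I : choiceType).
Implicit Types (q : freemod R I) (s : seq I).

Definition coef q i : R := val q i.

Lemma coef_lin i : lin (coef ^~ i : freemod R I -> R^o).
Proof. by []. Qed.

Lemma coef_inj q1 q2 : coef q1 =1 coef q2 -> q1 = q2.
Proof. by move=> eqq; apply/val_inj/funext. Qed.

Lemma coef_finsupp q : exists s, forall i, i \notin s -> coef q i = 0.
Proof. exact/finsuppP/(valP q). Qed.

Definition supp q := undup (projT1 (cid (coef_finsupp q))).

Lemma supp_uniq q : uniq (supp q).
Proof. exact: undup_uniq. Qed.

Lemma coef_supp q i : i \notin supp q -> coef q i = 0.
Proof. by rewrite /supp mem_undup; case: cid => s /= sP; apply: sP. Qed.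

Fact delta_subproof i : (fun j => (i == j)%:R : R^o) \in @finsupp R I.
Proof.
apply/finsuppP; exists [:: i] => j; rewrite inE eq_sym.
by case: eqP.
Qed.
Definition delta i : freemod R I := FreeMod (delta_subproof i).

Lemma coef_delta i j : coef (delta i) j = (i == j)%:R.
Proof. by []. Qed.

Definition free_ext (A : lmodType R) (a : I -> A) q : A :=
  \sum_(i <- supp q) coef q i *: a i.

Lemma free_extE (A : lmodType R) (a : I -> A) q s :
  uniq s -> (forall i, i \notin s -> coef q i = 0) ->
  free_ext a q = \sum_(i <- s) coef q i *: a i.
Proof.
move=> us qs; apply: big_uniq_support; rewrite ?supp_uniq // => i.
  by move/coef_supp=> ->; rewrite scale0r.
by move/qs=> ->; rewrite scale0r.
Qed.

Lemma free_ext_lin (A : lmodType R) (a : I -> A) : lin (free_ext a).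
Proof.
move=> c x y; pose s := undup (supp x ++ supp y).
have us : uniq s by exact: undup_uniq.
have xs i : i \notin s -> coef x i = 0.
  by rewrite mem_undup mem_cat negb_or => /andP[/coef_supp].
have ys i : i \notin s -> coef y i = 0.
  by rewrite mem_undup mem_cat negb_or => /andP[_ /coef_supp].
rewrite (free_extE _ us xs) (free_extE _ us ys) (free_extE _ us); last first.
  by move=> i nis; rewrite coef_lin xs // ys // scaler0 addr0.
rewrite scaler_sumr -big_split; apply: eq_bigr => i _ /=.
by rewrite coef_lin scalerDl scalerA.
Qed.

Lemma free_ext_delta (A : lmodType R) (a : I -> A) i :
  free_ext a (delta i) = a i.
Proof.
rewrite (@free_extE _ _ _ [:: i]) //; last first.
  by move=> j; rewrite inE coef_delta eq_sym; case: eqP.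
by rewrite big_seq1 coef_delta eqxx scale1r.
Qed.

Lemma free_ext_basis q : free_ext delta q = q.
Proof.
apply: coef_inj => i; rewrite (lin_sum (coef_lin i)).
have [iq|niq] := boolP (i \in supp q).
  rewrite (bigD1_seq i) ?supp_uniq //= big1 => [|j /negPf nji].
    by rewrite (linZ (coef_lin i)) coef_delta eqxx addr0 [_ *: _]mulr1.
  by rewrite (linZ (coef_lin i)) coef_delta nji scaler0.
rewrite (coef_supp niq) big_seq big1 // => j jq.
have /negPf nji : j != i by apply: contraNneq niq => <-.
by rewrite (linZ (coef_lin i)) coef_delta nji scaler0.
Qed.

Lemma lin_freeE (A : lmodType R) (f : freemod R I -> A) q :
  lin f -> f q = free_ext (fun i => f (delta i)) q.
Proof.
move=> linf; rewrite -{1}(free_ext_basis q) /free_ext (lin_sum linf).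
by apply: eq_bigr => i _; rewrite (linZ linf).
Qed.

Lemma projective_free : projective (freemod R I).
Proof.
move=> A B g f ling surjg linf.
have [a aE] := choice (fun i => surjg (f (delta i))).
exists (free_ext a); split=> [|x]; first exact: free_ext_lin.
rewrite (lin_freeE x linf) (lin_freeE x (lin_comp ling (free_ext_lin a))).
by congr (free_ext _ x); apply/funext => i; rewrite free_ext_delta.
Qed.

End FreeModuleTheory.

(** * Finite free modules and dual bases *)

Section Projective.
Variable R : pzRingType.

Lemma sum_delta_fct n (c : 'I_n -> R^o) :
  c = \sum_(i < n) c i *: (fun j : 'I_n => (i == j)%:R : R^o).
Proof.
apply/funext => j; rewrite fct_sumE (bigD1 j) //= big1 => [|i /negPf nij].
  by rewrite addr0 !fctE eqxx [_ *: _]mulr1.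
by rewrite !fctE nij [_ *: _]mulr0.
Qed.

Lemma lin_comb n (A : lmodType R) (a : 'I_n -> A) :
  lin (fun c : 'I_n -> R^o => \sum_(i < n) (c i : R) *: a i).
Proof.
move=> r x y; rewrite scaler_sumr -big_split; apply: eq_bigr => i _ /=.
by rewrite !fctE scalerDl scalerA.
Qed.

Lemma projective_fct n : projective ('I_n -> R^o).
Proof.
move=> A B g f ling surjg linf.
have [a aE] := choice (fun i => surjg (f (fun j : 'I_n => (i == j)%:R : R^o))).
exists (fun c => \sum_(i < n) (c i : R) *: a i); split=> [|c]; first exact: lin_comb.
rewrite {2}(sum_delta_fct c) (lin_sum ling) (lin_sum linf).
by apply: eq_bigr => i _; rewrite (linZ ling) (linZ linf) aE.
Qed.

(** The canonical map onto [Q] from the free module on its underlying set splits. The coordinates of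
    the section form a dual basis, and finitely many vectors involve only finitely many of them. *)
Lemma finite_dual_basis (Q : lmodType R) (qs : seq Q) : projective Q ->
  exists (m : nat) (e : 'I_m -> Q) (xi : 'I_m -> Q -> R^o),
    (forall i, lin (xi i)) /\
    forall q, q \in qs -> q = \sum_(i < m) (xi i q : R) *: e i.
Proof.
move=> projQ; pose g := @free_ext R Q Q id.
have surjg q : exists x, g x = q by exists (delta R q); rewrite /g free_ext_delta.
have [h [linh hE]] :=
  projQ _ _ g id (free_ext_lin _) surjg (fun _ _ _ => erefl).
pose s := undup (flatten [seq supp (h q) | q <- qs]).
exists (size s), (fun i => tnth (in_tuple s) i),
  (fun i q => coef (h q) (tnth (in_tuple s) i)).
split=> [i|q qqs]; first by move=> a x y; rewrite linh.
rewrite -[LHS]hE /g (@free_extE _ _ _ _ _ s) ?undup_uniq //.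
  by rewrite big_tnth.
move=> i nis; apply: coef_supp; apply: contra nis => ih.
by rewrite mem_undup; apply/flatten_mapP; exists q.
Qed.

End Projective.

(** * Right-linear functionals and the topology of [P + Q^*] *)

Section RightDual.
Variables (R : pzRingType) (Q : lmodType R^c).

Lemma rlinP (f : Q -> R) : rlin f <-> lin (f : Q -> (R^c)^o).
Proof. by []. Qed.

Lemma rlin_comb m (c : 'I_m -> R) (xi : 'I_m -> Q -> (R^c)^o) :
  (forall i, lin (xi i)) -> rlin (fun q => \sum_(i < m) c i * xi i q).
Proof.
move=> linxi a q q'; rewrite mulr_suml -big_split; apply: eq_bigr => i _ /=.
by rewrite (linxi i) mulrDr mulrA.
Qed.

Lemma rlin_sum (f : Q -> R) m (c : 'I_m -> R) (e : 'I_m -> Q) : rlin f ->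
  f (\sum_(i < m) (c i : R^c) *: e i) = \sum_(i < m) f (e i) * c i.
Proof.
move=> /rlinP linf; rewrite (lin_sum linf).
by apply: eq_bigr => i _; rewrite (linZ linf).
Qed.

Lemma rlin_cst0 : rlin (fun _ : Q => 0 : R).
Proof. by move=> a q q'; rewrite mul0r addr0. Qed.

Lemma rlin_scaleD a (f f' : Q -> R) :
  rlin f -> rlin f' -> rlin (fun q => a * f q + f' q).
Proof.
move=> linf linf' b q q'; rewrite linf linf' !mulrDr !mulrDl !mulrA.
abel.
Qed.

End RightDual.

Lemma PQ_openI (R : pzRingType) (P : lmodType R) (Q : lmodType R^c)
    (U U' : P -> (Q -> R) -> Prop) :
  PQ_open U -> PQ_open U' -> PQ_open (fun x f => U x f /\ U' x f).
Proof.
move=> [Ur Uo] [Ur' Uo']; split=> [x f [/Ur]//|x f [/Uo[s sP] /Uo'[s' sP']]].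
exists (s ++ s') => g ling gE; split.
  by apply: sP => // q qs; apply: gE; rewrite mem_cat qs.
by apply: sP' => // q qs; apply: gE; rewrite mem_cat qs orbT.
Qed.

Section Submodule.
Variables (R : pzRingType) (M : lmodType R) (S : M -> Prop).
Hypothesis subS : submod S.

Lemma submodD x y : S x -> S y -> S (x + y).
Proof. by move=> Sx Sy; rewrite -[x]scale1r; apply: subS.2. Qed.

Lemma submodZ a x : S x -> S (a *: x).
Proof. by move=> Sx; rewrite -[_ *: _]addr0; apply: subS.2 => //; case: subS. Qed.

End Submodule.

Lemma lattice_fintype (R : pzRingType) (M : lmodType R) (T : (M -> Prop) -> Prop)
    (L : M -> Prop) : open_submod T L ->
  (forall U : M -> Prop, open_submod T U -> (forall x, U x -> L x) ->
     exists (J : finType) (s : J -> M), (forall i, L (s i)) /\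
       forall x, L x -> exists c : J -> R, U (x - \sum_i c i *: s i)) ->
  lattice T L.
Proof.
move=> oL LP; split=> // U oU UL; have [J [s [sL sP]]] := LP U oU UL.
exists #|J|, (fun i => s (enum_val i)); split=> // x Lx.
have [c cP] := sP x Lx; exists (fun i => c (enum_val i)).
suff -> : \sum_(i < #|J|) c (enum_val i) *: s (enum_val i) =
  \sum_i c i *: s i by [].
by rewrite [RHS](reindex _ (onW_bij _ (enum_val_bij J))).
Qed.

(** * Part (b): from bounded to lattice *)

Section TwoAlmostProjective.
Variables (R : pzRingType) (M0 M : lmodType R) (T : (M -> Prop) -> Prop).
Variables (L : M -> Prop) (pi : M -> M0).
Hypotheses (tateT : tate T) (openL : open_submod T L) (quotL : quot_rep L pi).

(** Preimages under [p] can be intersected in [P + Q^*]; pulling back along [i] recovers the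
    original sets because [p i = 1]. *)
Lemma tate_openI (U V : M -> Prop) : T U -> T V -> T (fun m => U m /\ V m).
Proof.
have [P [Q [_ [_ [i1 [i2 [p [_ [ri2 [_ [_ [pK [ci cp]]]]]]]]]]]]] := tateT.
move=> /cp oU /cp oV; have := ci _ (PQ_openI oU oV); congr T.
by apply/funext => m; rewrite pK; apply/propext; split=> [[[_ ?] []]|[]].
Qed.

(* Every discrete quotient of [P (+) Q^*] factors through [P (+) R^m], which
   is projective: this replaces projectivity of [M]. *)
Lemma tate_lift (A B : lmodType R) (g : A -> B) (f : M0 -> B) :
  lin g -> (forall b, exists a, g a = b) -> lin f ->
  exists (lam : M -> A) (W : M -> Prop),
    [/\ lin lam, forall m, g (lam m) = f (pi m), open_submod T W &
        forall m, W m -> lam m = 0].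
Proof.
move=> ling surjg linf; have [linpi [_ kerpi]] := quotL.
have [P [Q [projP [projQ [i1 [i2 [p [lini1 [ri2 [li2 [linp [pK [ci cp]]]]]]]]]]]]]
  := tateT.
have p0 : p 0 (fun=> 0) = 0.
  have := linp (-1) 0 0 _ _ (@rlin_cst0 _ Q) (@rlin_cst0 _ Q).
  rewrite scaler0 addr0 scaleN1r addNr => <-; congr p.
  by apply/funext => q; rewrite mulr0 addr0.
(* By continuity, [p] sends into [L] a basic neighbourhood of 0, given by a finite list [qs]. *)
have [_ openpL] := cp _ openL.2.
have /openpL[qs qsP] : rlin (fun _ : Q => 0 : R) /\ L (p 0 (fun=> 0)).
  by split; [exact: rlin_cst0|rewrite p0; case: openL.1].
have [m [e [xi [linxi eP]]]] := finite_dual_basis qs projQ.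
pose comb (c : 'I_m -> R^o) q := \sum_(i < m) (c i : R) * xi i q.
have rcomb c : rlin (comb c) by exact: rlin_comb.
pose phi (y : P * ('I_m -> R^o)) := f (pi (p y.1 (comb y.2))).
have linphi : lin phi.
  move=> a [x c] [x' c']; rewrite /phi /= -linf -linpi -linp //.
  congr (f (pi (p _ _))); apply/funext => q; rewrite /comb mulr_sumr -big_split.
  by apply: eq_bigr => i _; rewrite /= !fctE mulrDl mulrA.
have [lam [linlam lamE]] := projective_pair projP (@projective_fct R m)
  ling surjg linphi.
pose ev (x : M) : P * ('I_m -> R^o) := (i1 x, fun i => i2 x (e i)).
have linev : lin ev.
  by move=> a x y; rewrite /ev lini1; congr (_, _); apply/funext => i; rewrite li2.
exists (fun x => lam (ev x)), (fun x => ev x = 0); split.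
- exact: lin_comp.
- move=> x; rewrite lamE /phi; congr f.
  (* By the dual basis, [i2 x] and the combination built from [ev x] agree on [qs], so exchanging
     them changes the value of [p] only by an element of [L]. *)
  apply/eqP; rewrite eq_sym -subr_eq0 -linB //; apply/eqP/kerpi.
  rewrite -{1}(pK x) addrC -scaleN1r -linp //=.
  have -> : -1 *: i1 x + i1 x = 0 by rewrite scaleN1r addNr.
  apply: (qsP _ _ _).2 => [|q /eP qE]; first exact: rlin_scaleD.
  rewrite {2}qE rlin_sum // mulN1r addrC; apply/eqP; rewrite subr_eq0; apply/eqP.
  by apply: eq_bigr.
- split.
    split; first by rewrite lin0.
    by move=> a x y evx evy; rewrite linev evx evy scaler0 addr0.
  pose U (x : P) (h : Q -> R) := rlin h /\ (x = 0 /\ forall i, h (e i) = 0).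
  have oU : PQ_open U.
    split=> [x h []//|x h [rh [x0 h0]]].
    exists [seq e i | i <- enum 'I_m] => h' rh' hE; split=> //; split=> // i.
    by rewrite hE ?h0 //; apply/map_f; rewrite mem_enum.
  have := ci _ oU; congr T; apply/funext => x; apply/propext; split.
    by move=> [_ [x0 h0]]; rewrite /ev x0; congr (_, _); apply/funext.
  move=> [x0 h0]; split=> //; split=> // i.
  by have := congr1 (fun h => h i) h0.
- by move=> x ->; rewrite lin0.
Qed.

Lemma two_almost_projective_lattice :
  two_almost_projective M0 -> bounded T L -> lattice T L.
Proof.
move=> [P [F [projP [[n [s [gens [k [rel [rel0 relP]]]]]] [i0 [pr [lini [linpr iK]]]]]]]].
move=> [Lam [[_ LamP] LLam]]; have [linpi [surjpi kerpi]] := quotL.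
pose comb (c : 'I_n -> R^o) := \sum_(i < n) (c i : R) *: s i.
pose rho (y : P * ('I_n -> R^o)) : P * F := (y.1, comb y.2).
have linrho : lin rho.
  by move=> a x y; rewrite /rho /comb lin_comb.
have surjrho y : exists x, rho x = y.
  by case: y => x y; have [c ->] := gens y; exists (x, c).
have [sig [linsig sigE]] := projective_pair projP (@projective_fct R n)
  linpi surjpi (lin_comp linpr linrho).
have [lam [W [linlam lamE openW lamW]]] := tate_lift linrho surjrho lini.
pose th x := x - sig (lam x).
have linth : lin th.
  move=> a x y; rewrite /th linlam linsig scalerBr; abel.
have thL x : L (th x).
  by apply/kerpi; rewrite /th linB // sigE lamE iK subrr.
have relL j : L (sig (0, rel j)).
  apply/kerpi; rewrite sigE -[RHS](lin0 linpr); congr pr.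
  by rewrite /rho /comb /= rel0.
apply: lattice_fintype => // U openU UL.
(* The remainder is also required to lie in [W], where [lam] vanishes and [th] is the identity. *)
have [] := LamP (fun x => U x /\ W x).
- split; last exact: tate_openI openU.2 openW.2.
  split; first by split; [case: openU.1|case: openW.1].
  by move=> a x y [Ux Wx] [Uy Wy]; split; [apply: openU.1.2|apply: openW.1.2].
- by move=> x [/UL/LLam].
move=> N [t [tLam tP]].
exists ('I_N + 'I_k)%type,
  (fun i => match i with inl i => th (t i) | inr j => sig (0, rel j) end).
split=> [[i|j]//|x Lx].
have [c [Uc Wc]] := tP _ (LLam _ Lx).
(* Here [rho (lam x) = i0 0 = 0], so [lam x] has zero [P]-part and is a relation among the
   generators of [F]. *)
have [d dE] : exists d : 'I_k -> R, lam x = (0, fun i => \sum_(j < k) d j * rel j i).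
  have /kerpi pix := Lx; have := lamE x; rewrite pix (lin0 lini).
  by case: (lam x) => y r [/= -> /relP[d dE]]; exists d; congr (_, _); apply/funext.
exists (fun i => match i with inl i => c i | inr j => d j end).
rewrite big_sumType /=.
(* Since [sig (lam x) = x - th x], the left side is [th] of the remainder, hence the remainder
   itself. *)
suff -> : x - (\sum_(i < N) c i *: th (t i) + \sum_(j < k) d j *: sig (0, rel j))
   = x - \sum_(i < N) c i *: t i by [].
have -> : \sum_(i < N) c i *: th (t i) = th (\sum_(i < N) c i *: t i).
  by rewrite (lin_sum linth); apply: eq_bigr => i _; rewrite (linZ linth).
have -> : \sum_(j < k) d j *: sig (0, rel j) = sig (lam x).
  rewrite dE; transitivity (sig (\sum_(j < k) d j *: ((0, rel j) : P * ('I_n -> R^o)))).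
    by rewrite (lin_sum linsig); apply: eq_bigr => j _; rewrite (linZ linsig).
  congr sig; rewrite [LHS]surjective_pairing; congr (_, _).
    by rewrite (lin_sum (f := fst)) // big1 // => j _; rewrite /= scaler0.
  rewrite (lin_sum (f := snd)) //; apply/funext => i.
  by rewrite fct_sumE; apply: eq_bigr.
have th0 : th (x - \sum_(i < N) c i *: t i) = x - \sum_(i < N) c i *: t i.
  by rewrite /th lamW // (lin0 linsig) subr0.
rewrite -[RHS]th0 (linB linth) {2}/th; abel.
Qed.

End TwoAlmostProjective.

(** * Endomorphisms idempotent up to an error through [V] *)

Section Stages.
Variables (R : pzRingType) (V : lmodType R).

(** The module [V] stays fixed while [sG] varies, so every iteration adjoins the same summand
    [V + V]. *)
Record stage := Stage {
  sG : lmodType R;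
  sp : sG -> sG;
  sa : sG -> V;
  sb : V -> sG;
  sp_lin : lin sp;
  sa_lin : lin sa;
  sb_lin : lin sb;
  sbaE : forall g, sb (sa g) = sp g - sp (sp g) }.

Variable S : stage.
Local Notation p := (@sp S).
Local Notation a := (@sa S).
Local Notation b := (@sb S).
Local Notation G' := (sG S * (V * V))%type.

Let linE := (linD (@sp_lin S), linD (@sa_lin S), linD (@sb_lin S),
  linN (@sp_lin S), linN (@sa_lin S), linN (@sb_lin S),
  linMn (@sp_lin S), linMn (@sa_lin S), linMn (@sb_lin S)).
Let linZE := (linZ (@sp_lin S), linZ (@sa_lin S), linZ (@sb_lin S)).

(* On [G (+) (V (+) V)] let [r = [[p, (b, p b)], [(a, 0), 1 - t]]], where
   [t (x, y) = (- a b y, x + y)] lifts [p] along [(b, p b) : V (+) V -> G].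
   Then [next_h r = p next_h] and [r - r^2 = (0, (- a p, a)) next_h], which gives
   the closed forms below for [next_p = 3 r^2 - 2 r^3] and for the factorization
   [next_b next_a] of its error. *)
Definition next_h (z : G') : sG S := z.1 + b z.2.2.

Definition next_p (z : G') : G' :=
  let h := next_h z in
  (p h + b z.2.1,
   (z.2.1 + a (h + p h - p (p h) *+ 2), a (p h *+ 2 - h) - z.2.1)).

Definition next_a (z : G') : V := a (next_h z).

Definition next_b (v : V) : G' :=
  let u := b (v *+ 3 + a (b v) *+ 4) in (0, (- a (p u), a u)).

Lemma next_h_lin : lin next_h.
Proof.
by move=> c x y; rewrite /next_h /= !linE !linZE !scalerDr; abel.
Qed.

Lemma next_a_lin : lin next_a.
Proof. exact: lin_comp (@sa_lin S) next_h_lin. Qed.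

Lemma next_p_lin : lin next_p.
Proof.
move=> c x y; rewrite /next_p next_h_lin; move: (next_h x) (next_h y) => hx hy.
congr (_, (_, _)); rewrite /= !linE !linZE !(scalerDr, scalerN, =^~ scalerMnr); abel.
Qed.

Lemma next_b_lin : lin next_b.
Proof.
move=> c x y; congr (_, (_, _)); rewrite /= ?scaler0 ?addr0 //;
  rewrite !linE !linZE !(scalerDr, scalerN, =^~ scalerMnr) ?linE ?linZE; abel.
Qed.

(** As [next_h r = p next_h], a polynomial in [r] is carried to the same polynomial in [p]. *)
Lemma next_h_p (z : G') :
  next_h (next_p z) = p (p (next_h z)) *+ 3 - p (p (p (next_h z))) *+ 2.
Proof.
rewrite {1}/next_h /=; move: (next_h z) => h.
rewrite !linE !(sbaE, linE); abel.
Qed.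

(** With [e = r - r^2], the error of [3 r^2 - 2 r^3] is [e^2 (3 + 4 e)], and
    [next_h e = b a next_h]; this accounts for the coefficients 3 and 4 in [next_b]. *)
Lemma next_baE (z : G') : next_b (next_a z) = next_p z - next_p (next_p z).
Proof.
rewrite [in X in _ - X]/next_p next_h_p /next_b /next_a /next_p /=.
move: (next_h z) => h; congr (_, (_, _)) => /=.
- rewrite !linE !(sbaE, linE); abel.
- rewrite !linE !(sbaE, linE); abel.
- rewrite !linE !(sbaE, linE); abel.
Qed.

Definition next : stage :=
  Stage next_p_lin next_a_lin next_b_lin next_baE.

(** On [(0, (- a p u, a u))] the first component is [p b a u - b a p u], which is zero because
    [b a = p - p^2] commutes with [p]. *)
Lemma next_pb1 (v : V) : (next_p (next_b v)).1 = 0.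
Proof.
rewrite /next_p /next_b /next_h /= add0r; move: (b (v *+ 3 + _)) => u.
rewrite !(sbaE, linE); abel.
Qed.

End Stages.

Section TwoStages.
Variables (R : pzRingType) (V : lmodType R) (S : stage V).
Implicit Types (z : sG (next S)) (w : V * V).

Lemma next_next_p z w :
  (next_p (S := next S) (z, w)).1 =
  next_p z + next_p (next_b S w.2) + next_b S w.1.
Proof. by rewrite -(linD (@next_p_lin _ _ S)). Qed.

Lemma fst_addE z z' : (z + z').1 = z.1 + z'.1.
Proof. by []. Qed.

(** Going one stage further adds terms in [next_b] and [next_p next_b], both invisible in [sG S].
    The projected operators therefore stabilize, which makes the limit well defined. *)
Lemma next_next_p1 z w : (next_p (S := next S) (z, w)).1.1 = (next_p z).1.
Proof. by rewrite next_next_p !fst_addE next_pb1 !addr0. Qed.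

(** The error [next_p - next_p^2] takes values in the image of [next_b], whose first component is
    zero. This is idempotence of the limit seen at one stage. *)
Lemma next_p_idem1 z w :
  (next_p (next_p (S := next S) (z, w)).1).1 = (next_p z).1.
Proof.
have pp x : (next_p (next_p x)).1 = (next_p (S := S) x).1.
  have := next_baE x => /(congr1 fst) /= /esym /eqP.
  by rewrite subr_eq0 => /eqP.
by rewrite next_next_p !(linD (@next_p_lin _ _ S)) !fst_addE !pp !next_pb1 !addr0.
Qed.

End TwoStages.

(** * Passage to the limit *)

Section Limit.
Variables (R : pzRingType) (n : nat) (S0 : stage ('I_n -> R^o)).
Local Notation V := ('I_n -> R^o).
Local Notation I := (nat * (bool * 'I_n))%type.
Local Notation X := (sG S0 * (I -> R^o))%type.

Fixpoint tower k : stage V := if k is k'.+1 then next (tower k') else S0.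

Definition level (f : I -> R^o) k : V * V :=
  (fun i => f (k, (false, i)), fun i => f (k, (true, i))).

Fixpoint trunc k (z : X) : sG (tower k) :=
  match k return sG (tower k) with
  | 0 => z.1
  | k'.+1 => (trunc k' z, level z.2 k')
  end.

Definition level_entry (w : V * V) (i : bool * 'I_n) : R^o :=
  if i.1 then w.2 i.2 else w.1 i.2.

(** The operator on [tower k.+1] is final only after projection to [tower k]. Level [k] is the last
    factor of [tower k.+1], so it is read off the operator on [tower k.+2]. *)
Definition limE (z : X) : X :=
  ((@next_p _ _ (tower 0) (trunc 1 z)).1,
   fun i => level_entry (@next_p _ _ (tower i.1.+1) (trunc i.1.+2 z)).1.2 i.2).

Lemma level_entry_lin i : lin (level_entry ^~ i).
Proof. by rewrite /level_entry; case: i.1. Qed.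

Lemma trunc_lin k : lin (@trunc k).
Proof. by elim: k => [|k IH] c x y //=; rewrite IH. Qed.

Lemma limE_lin : lin limE.
Proof.
have linp k : lin (fun z => (@next_p _ _ (tower k) (trunc k.+1 z)).1).
  move=> c x y; rewrite trunc_lin.
  exact: (congr1 fst (@next_p_lin _ _ (tower k) c (trunc k.+1 x) (trunc k.+1 y))).
move=> c x y; congr (_, _); first exact: (linp 0%N).
apply/funext => i; rewrite [LHS](congr1 (fun w => level_entry w.2 i.2)
  (linp i.1.+1 c x y)).
exact: level_entry_lin.
Qed.

Lemma trunc_limE k z :
  trunc k (limE z) = (@next_p _ _ (tower k) (trunc k.+1 z)).1.
Proof.
elim: k => [|k IH]; first by [].
rewrite [LHS]/= IH [RHS]surjective_pairing; congr (_, _).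
exact/esym/(@next_next_p1 _ _ (tower k) (trunc k.+1 z) (level z.2 k.+1)).
Qed.

Lemma trunc_inj z z' : (forall k, trunc k z = trunc k z') -> z = z'.
Proof.
case: z z' => [g f] [g' f'] eqt; congr (_, _); first exact: (eqt 0%N).
apply/funext => -[k [b i]]; have [_ f0 f1] := eqt k.+1.
by case: b; [have := congr1 (fun h => h i) f1|have := congr1 (fun h => h i) f0].
Qed.

Lemma limE_idem z : limE (limE z) = limE z.
Proof.
apply: trunc_inj => k; rewrite !trunc_limE.
exact: (@next_p_idem1 _ _ (tower k) (trunc k.+1 z) (level z.2 k.+1)).
Qed.

Lemma trunc_local k (z z' : X) : z.1 = z'.1 ->
  (forall j i, (j < k)%N -> z.2 (j, i) = z'.2 (j, i)) -> trunc k z = trunc k z'.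
Proof.
move=> eq1; elim: k => // k IH eq2 /=.
rewrite IH; last by move=> j i ltjk; apply/eq2/ltnW.
by congr (_, (_, _)); apply/funext => i; rewrite eq2.
Qed.

End Limit.

(** Uniform continuity for discrete [A] and [B] and pointwise convergence on [I -> B]: the list [t]
    works at every point. *)
Definition finitary (A B : Type) (I : eqType) (E : A * (I -> B) -> A * (I -> B)) :=
  forall s : seq I, exists t : seq I, forall x f f',
    (forall i, i \in t -> f i = f' i) ->
    (E (x, f)).1 = (E (x, f')).1 /\
    forall i, i \in s -> (E (x, f)).2 i = (E (x, f')).2 i.

Lemma limE_finitary (R : pzRingType) (n : nat) (S0 : stage ('I_n -> R^o)) :
  finitary (@limE R n S0).
Proof.
(* Level [k] of the output is computed from [trunc k.+2], that is, from levels below [k.+2]. *)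
move=> s; pose N := (\max_(i <- s) i.1).+2.
exists [seq (j, i) | j <- iota 0 N, i <- enum {: bool * 'I_n}] => x f f' eqf.
have eqt k : (k <= N)%N -> trunc k (x, f) = trunc k (x, f').
  move=> lekN; apply: trunc_local => // j i ltjk; apply: eqf.
  by apply: allpairs_f; rewrite ?mem_enum // mem_iota (leq_trans ltjk).
split=> [|i si]; first by rewrite /limE eqt.
have leN : (i.1.+2 <= N)%N by rewrite !ltnS; exact: leq_bigmax_seq.
exact: (congr1 (fun t =>
  level_entry (@next_p _ _ (tower S0 i.1.+1) t).1.2 i.2) (eqt _ leN)).
Qed.

(** * The image of a linear idempotent *)

Section Fixed.
Variables (R : pzRingType) (X : lmodType R) (E : X -> X).
Hypotheses (linE : lin E) (idemE : forall x, E (E x) = E x).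

(** The proof of linearity is a parameter of the predicate so that the submodule structure can be
    inferred from the term alone. *)
Definition fixed of lin E : {pred X} := [pred x | E x == x].

Fact fixed_submod_closed : submod_closed (fixed linE).
Proof.
split=> [|a x y]; rewrite !inE; first by rewrite (lin0 linE).
by move=> /eqP Ex /eqP Ey; rewrite linE Ex Ey.
Qed.
HB.instance Definition _ :=
  GRing.isSubmodClosed.Build R X (fixed linE) fixed_submod_closed.

Record fixmod := FixMod { fixval : X; _ : fixval \in fixed linE }.
HB.instance Definition _ := [isSub for fixval].
HB.instance Definition _ := [Choice of fixmod by <:].
HB.instance Definition _ := [SubChoice_isSubLmodule of fixmod by <:].

Lemma fixvalK (m : fixmod) : E (fixval m) = fixval m.
Proof. exact/eqP/(valP m). Qed.

Lemma fixval_lin : lin fixval.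
Proof. by []. Qed.

Fact fixproj_subproof x : E x \in fixed linE.
Proof. by rewrite inE idemE. Qed.
Definition fixproj x : fixmod := FixMod (fixproj_subproof x).

Lemma fixprojE x : fixval (fixproj x) = E x.
Proof. by []. Qed.

Lemma fixproj_lin : lin fixproj.
Proof. by move=> a x y; apply: val_inj; apply: linE. Qed.

Lemma fixprojK (m : fixmod) : fixproj (fixval m) = m.
Proof. exact/val_inj/fixvalK. Qed.

End Fixed.

(** * The Tate topology on the image *)

Section TateFixed.
Variables (R : pzRingType) (G : lmodType R) (I : choiceType).
Local Notation X := (G * (I -> R^o))%type.
Variable E : X -> X.
Hypotheses (projG : projective G) (linE : lin E).
Hypotheses (idemE : forall x, E (E x) = E x) (finE : finitary E).
Local Notation Q := (freemod R^c I).
Local Notation M := (fixmod linE).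

Definition fix_i1 (m : M) : G := (fixval m).1.
(** A functional on the free right module [Q] is an arbitrary family of values on its basis, so
    [I -> R] is [Q^*]; [fix_p] uses the inverse identification. *)
Definition fix_i2 (m : M) : Q -> R := @free_ext R^c I (R^c)^o (fixval m).2.
Definition fix_p (x : G) (f : Q -> R) : M :=
  fixproj linE idemE (x, fun i => f (delta R^c i)).
(** The quotient topology along [fix_p]. Continuity of the inclusion then amounts to continuity of
    [E]. *)
Definition fix_top (U : M -> Prop) : Prop :=
  PQ_open (fun x f => rlin f /\ U (fix_p x f)).

Lemma free_extRE (c : I -> R) (q : Q) :
  @free_ext R^c I (R^c)^o c q = \sum_(i <- supp q) c i * coef q i :> R.
Proof. by []. Qed.

Lemma tate_fix_top : tate fix_top.
Proof.
exists G, Q; split=> //; split; first exact: projective_free.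
exists fix_i1, fix_i2, fix_p; split=> //; split.
  by move=> m; apply/rlinP/free_ext_lin.
split.
  move=> a m m' q; rewrite /fix_i2 !free_extRE mulr_sumr -big_split.
  by apply: eq_bigr => i _; rewrite /= mulrA -mulrDl.
split; first by move=> a x x' f f' _ _; rewrite /fix_p -fixproj_lin.
have fix_pK m : fix_p (fix_i1 m) (fix_i2 m) = m.
  rewrite -[RHS](fixprojK idemE); congr fixproj.
  rewrite [RHS]surjective_pairing; congr (_, _).
  by apply/funext => i; rewrite /fix_i2 free_ext_delta.
split=> //; split=> // U oU; split=> [x f []//|x f [rf /oU.2[qs qsP]]].
(* Values on [qs] depend only on the coordinates in their supports, and [t] controls those
   coordinates of the output of [E]. *)
have [t tP] := finE (flatten [seq supp q | q <- qs]).
exists [seq delta R^c i | i <- t] => g rg eqfg; split=> //.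
have [eq1 eq2] := tP x (fun i => g (delta R^c i)) (fun i => f (delta R^c i))
  (fun i it => eqfg _ (map_f _ it)).
have -> : fix_i1 (fix_p x g) = fix_i1 (fix_p x f) by [].
apply: qsP; first exact/rlinP/free_ext_lin.
move=> q qqs; rewrite /fix_i2 !free_extRE big_seq [RHS]big_seq.
apply: eq_bigr => i iq; congr (_ * _); apply: eq2.
by apply/flatten_mapP; exists q.
Qed.

Lemma PQ_open_cst (U : G -> (Q -> R) -> Prop) :
  (forall x f g, rlin f -> rlin g -> U x f -> U x g) ->
  PQ_open (fun x f => rlin f /\ U x f).
Proof.
move=> UP; split=> [x f []//|x f [rf Uf]]; exists [::] => g rg _.
by split=> //; apply: UP Uf.
Qed.

End TateFixed.

(** * The map onto [M0] and its bounded open kernel *)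

Section Quotient.
Variables (R : pzRingType) (P N M0 : lmodType R) (n : nat) (I : choiceType).
Local Notation G := (P * ('I_n -> R^o))%type.
Local Notation X := (G * (I -> R^o))%type.
Variables (E : X -> X) (rho : G -> N) (i0 : M0 -> N) (pr : N -> M0).
Hypotheses (linE : lin E) (idemE : forall x, E (E x) = E x).
Hypotheses (linrho : lin rho) (surjrho : forall y, exists x, rho x = y).
Hypotheses (rho0 : forall x, rho x = 0 -> x.1 = 0).
Hypotheses (lini0 : lin i0) (linpr : lin pr) (iK : forall x, pr (i0 x) = x).
Hypothesis rhoE : forall z, rho (E z).1 = i0 (pr (rho z.1)).
Local Notation M := (fixmod linE).
Local Notation T := (@fix_top R G I E linE idemE).

Definition fix_pi (m : M) : M0 := pr (rho (fixval m).1).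
Definition fix_ker (m : M) : Prop := fix_pi m = 0.
(** The image under [E] of the standard lattice [R^n + R^I], with zero [P]-component. *)
Definition fix_lat (m : M) : Prop :=
  exists (v : 'I_n -> R^o) (f : I -> R^o), m = fixproj linE idemE ((0, v), f).

Lemma fix_pi_lin : lin fix_pi.
Proof. by move=> a x y; rewrite /fix_pi fixval_lin /= linrho linpr. Qed.

Lemma fix_piE z : fix_pi (fixproj linE idemE z) = pr (rho z.1).
Proof. by rewrite /fix_pi fixprojE rhoE iK. Qed.

Lemma quot_rep_fix : quot_rep fix_ker fix_pi.
Proof.
split; first exact: fix_pi_lin.
split=> [y|//]; have [x xE] := surjrho (i0 y).
by exists (fixproj linE idemE (x, 0)); rewrite fix_piE xE iK.
Qed.

Lemma open_fix_ker : open_submod T fix_ker.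
Proof.
split.
  split=> [|a x y]; first exact: lin0 fix_pi_lin.
  by rewrite /fix_ker fix_pi_lin => -> ->; rewrite scaler0 addr0.
by apply: PQ_open_cst => x f g _ _; rewrite /fix_ker /fix_p !fix_piE.
Qed.

(** An element of the kernel is fixed by [E], so [rhoE] gives [rho] of its first component as
    [i0 0 = 0]. Its [P]-component then vanishes, and it is its own preimage under [fixproj]. *)
Lemma fix_ker_lat m : fix_ker m -> fix_lat m.
Proof.
move=> m0; exists (fixval m).1.2, (fixval m).2; rewrite -{1}(fixprojK idemE m).
congr fixproj; rewrite {1}[fixval m]surjective_pairing; congr (_, _).
rewrite {1}[(fixval m).1]surjective_pairing; congr (_, _).
apply: rho0; rewrite -(fixvalK m) rhoE.
by move: m0; rewrite /fix_ker /fix_pi => ->; rewrite (lin0 lini0).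
Qed.

(** The image of the whole factor [I -> R] lies in [fix_lat], so changing [f] does not affect
    membership. *)
Lemma open_fix_lat : open_submod T fix_lat.
Proof.
have sub : submod fix_lat.
  split; first by exists 0, 0; rewrite (lin0 (fixproj_lin linE idemE)).
  move=> a _ _ [v [f ->]] [v' [f' ->]]; exists (a *: v + v'), (a *: f + f').
  rewrite -fixproj_lin; congr (fixproj _ _ ((_, _), _)).
  by rewrite /= scaler0 addr0.
split=> //; apply: PQ_open_cst => x f g _ _ latf.
have -> : fix_p linE idemE x g = fix_p linE idemE x f +
    fixproj linE idemE (0, fun i => g (delta R^c i) - f (delta R^c i)).
  rewrite /fix_p -(linD (fixproj_lin linE idemE)); congr (fixproj _ _ (_, _)).
    by rewrite /= addr0.
  by apply/funext => i; rewrite !fctE addrC subrK.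
apply: submodD => //; exists 0.
by exists (fun i => g (delta R^c i) - f (delta R^c i)).
Qed.

Lemma lattice_fix_lat : lattice T fix_lat.
Proof.
apply: (lattice_fintype open_fix_lat) => U [subU [_ oU]] _.
have [qs qsP] : exists qs : seq (freemod R^c I), forall g : freemod R^c I -> R,
    rlin g -> (forall q, q \in qs -> g q = 0) -> U (fix_p linE idemE 0 g).
  have [|qs qsP] := oU 0 (fun=> 0); last by exists qs => g rg /qsP[].
  split; first exact: rlin_cst0.
  by rewrite /fix_p (lin0 (fixproj_lin linE idemE)); case: subU.
(* Families vanishing on [s] give functionals that kill [qs] and so land in [U]. Modulo [U] only
   [R^n] and the coordinates in [s] remain. *)
pose s := undup (flatten [seq supp q | q <- qs]).
pose d (i j : I) : R^o := (i == j)%:R.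
pose gen (j : 'I_n + 'I_(size s)) : M :=
  match j with
  | inl i => fixproj linE idemE ((0, fun k => (i == k)%:R), 0)
  | inr i => fixproj linE idemE (0, d (tnth (in_tuple s) i))
  end.
exists ('I_n + 'I_(size s))%type, gen; split.
  case=> i; first by exists (fun k => (i == k)%:R), 0.
  by exists 0, (d (tnth (in_tuple s) i)).
move=> _ [v [f ->]].
exists (fun j => match j with inl i => v i | inr i => f (tnth (in_tuple s) i) end).
pose f' : I -> R^o := fun i => if i \in s then 0 else f i.
have fE : f = f' + \sum_(i <- s) (f i : R) *: d i.
  apply/funext => j; rewrite /f' !fctE fct_sumE.
  have [js|njs] := boolP (j \in s).
    rewrite (bigD1_seq j) ?undup_uniq //= big1 => [|i /negPf nij].
      by rewrite add0r addr0 !fctE /d eqxx [_ *: _]mulr1.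
    by rewrite !fctE /d nij scaler0.
  rewrite big_seq big1 ?addr0 // => i si; rewrite !fctE /d.
  by have /negPf-> : i != j by [apply: contraNneq njs => <-]; rewrite scaler0.
have linF := fixproj_lin linE idemE.
have -> : fixproj linE idemE ((0, v), f) - \sum_j
    (match j with inl i => v i | inr i => f (tnth (in_tuple s) i) end : R) *: gen j
    = fixproj linE idemE (0, f').
  rewrite big_sumType /=.
  have -> : \sum_(i < n) (v i : R) *: fixproj linE idemE ((0, fun k => (i == k)%:R), 0)
      = fixproj linE idemE ((0, v), 0).
    have lini : lin (fun w : 'I_n -> R^o => ((0, w), 0) : X).
      by move=> a w w'; congr ((_, _), _); rewrite /= scaler0 addr0.
    rewrite {2}(sum_delta_fct v) (lin_sum (lin_comp linF lini)).
    by apply: eq_bigr => i _; rewrite (linZ (lin_comp linF lini)).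
  have -> : \sum_(i < size s) (f (tnth (in_tuple s) i) : R) *:
        fixproj linE idemE (0, d (tnth (in_tuple s) i))
      = fixproj linE idemE (0, \sum_(i <- s) (f i : R) *: d i).
    have lini : lin (fun w : I -> R^o => (0, w) : X).
      by move=> a w w'; congr (_, _); rewrite /= scaler0 addr0.
    rewrite (lin_sum (lin_comp linF lini)) [RHS]big_tnth.
    by apply: eq_bigr => i _; rewrite (linZ (lin_comp linF lini)).
  rewrite -(linD linF) -(linB linF); congr fixproj; congr (_, _).
    congr (_, _) => /=; first by rewrite addr0 subr0.
    by rewrite addr0 subrr.
  by rewrite /= add0r {1}fE addrK.
have -> : fixproj linE idemE (0, f') =
    fix_p linE idemE 0 (@free_ext R^c I (R^c)^o f').
  by congr (fixproj _ _ (_, _)); apply/funext => i; rewrite free_ext_delta.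
apply: qsP => [|q qqs]; first exact/rlinP/free_ext_lin.
rewrite free_extRE big_seq big1 // => i iq; rewrite /f'.
suff -> : i \in s by rewrite mul0r.
by rewrite mem_undup; apply/flatten_mapP; exists q.
Qed.

Lemma bounded_fix_ker : bounded T fix_ker.
Proof. exists fix_lat; split; [exact: lattice_fix_lat|exact: fix_ker_lat]. Qed.

End Quotient.

(** * The initial stage and part (a) *)

Section StartStage.
Variables (R : pzRingType) (G V : lmodType R).
Variables (q : G -> G) (j : V -> G) (k : G -> V).
Hypotheses (linq : lin q) (linj : lin j) (link : lin k).
Hypothesis jk : forall g, j (k (q g - q (q g))) = q g - q (q g).

Let c g := q g - q (q g).
Let p0 g := q (q g) *+ 3 - q (q (q g)) *+ 2.
Let a0 g := k (c g).
Let b0 v := c (j v) *+ 3 + c (c (j v)) *+ 4.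
Let linqE := (linD linq, linN linq, linMn linq).

Let c_lin : lin c.
Proof. by move=> a x y; rewrite /c !(linqE, linZ linq) scalerBr; abel. Qed.

Let p0_lin : lin p0.
Proof.
move=> a x y; rewrite /p0 !(linqE, linZ linq).
by rewrite !(scalerDr, scalerN, =^~ scalerMnr); abel.
Qed.

Let a0_lin : lin a0.
Proof. exact: lin_comp link c_lin. Qed.

Let b0_lin : lin b0.
Proof.
move=> a x y; rewrite /b0 /c linj !(linqE, linZ linq).
by rewrite !(scalerDr, scalerN, =^~ scalerMnr); abel.
Qed.

Let b0a0E g : b0 (a0 g) = p0 g - p0 (p0 g).
Proof. by rewrite /b0 /a0 jk /p0 /c !linqE; abel. Qed.

(* If [q] is idempotent up to an error [c = q - q^2] with values in the free
   module [V], then [3 q^2 - 2 q^3] is idempotent up to [c^2 (3 + 4 c)], which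
   factors through the finitely generated module [c V]. *)
Definition start_stage : stage V := Stage p0_lin a0_lin b0_lin b0a0E.

End StartStage.

Lemma limE1 (R : pzRingType) (n : nat) (S0 : stage ('I_n -> R^o))
    (z : sG S0 * (nat * (bool * 'I_n) -> R^o)) :
  (limE z).1 = sp z.1 + sp (sb S0 (level z.2 0).2) + sb S0 (level z.2 0).1.
Proof. by rewrite -(linD (@sp_lin _ _ S0)). Qed.

Lemma almost_projective_quotient (R : pzRingType) (M0 : lmodType R) :
  almost_projective M0 ->
  exists (M : lmodType R) (T : (M -> Prop) -> Prop) (L : M -> Prop) (pi : M -> M0),
    tate T /\ open_submod T L /\ bounded T L /\ quot_rep L pi.
Proof.
move=> [P [F [projP [[n [s gens]] [i0 [pr [lini [linpr iK]]]]]]]].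
pose comb (c : 'I_n -> R^o) := \sum_(i < n) (c i : R) *: s i.
pose rho (y : P * ('I_n -> R^o)) : P * F := (y.1, comb y.2).
have linrho : lin rho.
  by move=> a x y; rewrite /rho /comb lin_comb.
have surjrho y : exists x, rho x = y.
  by case: y => x y; have [c ->] := gens y; exists (x, c).
have rho0 x : rho x = 0 -> x.1 = 0 by case.
have projG := projective_pair projP (@projective_fct R n).
have line : lin (fun x => i0 (pr (rho x))).
  exact: lin_comp lini (lin_comp linpr linrho).
have [q [linq qE]] := projG _ _ _ _ linrho surjrho line.
have rhoc g : rho (q g - q (q g)) = 0 by rewrite linB // !qE iK subrr.
pose inV (v : 'I_n -> R^o) : P * ('I_n -> R^o) := (0, v).
have lininV : lin inV.
  by move=> a v v'; congr (_, _); rewrite /= scaler0 addr0.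
(* The kernel of [rho] has zero [P]-component, so the error of [q] lies in the summand [R^n]. *)
have inVK g : inV (q g - q (q g)).2 = q g - q (q g).
  by rewrite /inV -(rho0 _ (rhoc g)) -surjective_pairing.
pose S0 := start_stage linq lininV (k := snd) (fun _ _ _ => erefl) inVK.
pose E := @limE R n S0.
have linE : lin E by exact: limE_lin.
have idemE z : E (E z) = E z by exact: limE_idem.
(* The values of [sb] are built from errors [c] of [q], which [rho] kills. *)
have rhob v : rho (sb S0 v) = 0.
  pose c g := q g - q (q g).
  rewrite -[sb _ _]/(c (inV v) *+ 3 + c (c (inV v)) *+ 4).
  by rewrite (linD linrho) !(linMn linrho) !rhoc !mul0rn addr0.
(* For the idempotent [e = i0 pr] one has [3 e^2 - 2 e^3 = e], so [sp] still lifts [e]. *)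
have rhop g : rho (sp (s := S0) g) = i0 (pr (rho g)).
  rewrite -[sp _]/(q (q g) *+ 3 - q (q (q g)) *+ 2).
  by rewrite (linB linrho) !(linMn linrho) !qE !iK; abel.
have rhoE z : rho (E z).1 = i0 (pr (rho z.1)).
  rewrite /E limE1 (linD linrho) rhob addr0 (linD linrho) !rhop rhob.
  by rewrite (lin0 linpr) (lin0 lini) addr0.
exists (fixmod linE), (@fix_top R _ _ E linE idemE),
  (@fix_ker R P (P * F)%type M0 n _ E rho pr linE),
  (@fix_pi R P (P * F)%type M0 n _ E rho pr linE).
split; first by apply: tate_fix_top => //; exact: limE_finitary.
split; first exact: open_fix_ker rhoE.
split; first exact: bounded_fix_ker rhoE.
exact: quot_rep_fix rhoE.
Qed.

Theorem theorem4p1 (R : pzRingType) :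
  (forall M0 : lmodType R, almost_projective M0 ->
     exists (M : lmodType R) (T : (M -> Prop) -> Prop) (L : M -> Prop) (pi : M -> M0),
       tate T /\ open_submod T L /\ bounded T L /\ quot_rep L pi) /\
  (forall M0 : lmodType R, two_almost_projective M0 ->
     forall (M : lmodType R) (T : (M -> Prop) -> Prop) (L : M -> Prop) (pi : M -> M0),
       tate T -> open_submod T L -> bounded T L -> quot_rep L pi ->
       lattice T L).
Proof.
split=> M0 apM0; first exact: almost_projective_quotient.
move=> M T L pi tateT openL boundedL quotL.
exact: two_almost_projective_lattice quotL apM0 boundedL.
Qed.
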